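(* Let $G$ be a finite group and let $\Delta(G)$ be any one of the three graphs $\Gamma(G)$, $\Gamma^*(G)$, $\Gamma^{**}(G)$. Then $\Delta(G)$ is the complement of the line graph of some graph if and only if one of the following conditions holds: (1) $G$ is abelian. (2) $G$ is non-abelian and $G\cong D_4$ or $G\cong Q_8$.
   Context: All graphs are simple (no loops or multiple edges) and undirected; a graph with no vertices is allowed. The commuting graph $\Gamma(G)$ of a group $G$ is the simple undirected graph whose vertex set is the set of all elements of $G$, in which two distinct elements $x$ and $y$ are adjacent if and only if $xy=yx$. The graph $\Gamma^*(G)$ is the induced subgraph of $\Gamma(G)$ obtained by deleting the identity element of $G$. A dominating (dominant) vertex of a graph is a vertex adjacent to every other vertex, and $\Gamma^{**}(G)$ is the induced subgraph of $\Gamma(G)$ obtained by deleting all dominating vertices of $\Gamma(G)$; the set of dominating vertices of $\Gamma(G)$ is the center $Z(G)$, so $\Gamma^{**}(G)$ is the induced subgraph on $G\setminus Z(G)$ (with no vertices when $G$ is abelian). The line graph $L(\Gamma)$ of a graph $\Gamma$ is the graph whose vertices are the edges of $\Gamma$, two distinct vertices of $L(\Gamma)$ being adjacent if and only if the corresponding edges of $\Gamma$ share an endpoint. The complement $\overline{\Gamma}$ of a graph $\Gamma$ has the same vertex set, with two distinct vertices adjacent in $\overline{\Gamma}$ if and only if they are not adjacent in $\Gamma$. A graph is ''the complement of the line graph of some graph'' if it is isomorphic to $\overline{L(\Gamma)}$ for some simple graph $\Gamma$. $D_n$ denotes the dihedral group of order $2n$ (so $D_4$ has order $8$), and $Q_8$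 denotes the quaternion group of order $8$. *)

(* Defs.v *)
From mathcomp Require Import all_boot all_fingroup all_solvable.
From mathcomp Require Import classical_sets.

Set Implicit Arguments.
Unset Strict Implicit.
Unset Printing Implicit Defensive.

(* The vertex type is arbitrary, possibly empty and possibly infinite. *)
Record sgraph := SGraph {
  vertex :> Type;
  adj : vertex -> vertex -> Prop;
  adj_sym : forall x y, adj x y -> adj y x;
  adj_irrefl : forall x, ~ adj x x
}.

Definition graph_iso (A B : sgraph) : Prop :=
  exists f : A -> B, bijective f /\ forall x y, adj (f x) (f y) <-> adj x y.

Section Constructions.
Variable A : sgraph.

Section Induced.
Variable P : A -> Prop.

Definition induced_adj (u v : {x : A | P x}) : Prop := adj (sval u) (sval v).

Lemma induced_adj_sym u v : induced_adj u v -> induced_adj v u.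
Proof. exact: adj_sym. Qed.

Lemma induced_adj_irrefl u : ~ induced_adj u u.
Proof. exact: adj_irrefl. Qed.

Definition induced : sgraph := SGraph induced_adj_sym induced_adj_irrefl.
End Induced.

Definition dominating (x : A) : Prop := forall y : A, y <> x -> adj x y.

Definition complement_adj (x y : A) : Prop := x <> y /\ ~ adj x y.

Lemma complement_adj_sym x y : complement_adj x y -> complement_adj y x.
Proof. by move=> [nxy nadj]; split=> [/esym // | /adj_sym]. Qed.

Lemma complement_adj_irrefl x : ~ complement_adj x x.
Proof. by case. Qed.

Definition complement : sgraph :=
  SGraph complement_adj_sym complement_adj_irrefl.

(* Edges are unordered pairs, i.e. two-element sets of adjacent vertices. *)
Definition edge : Type :=
  {e : set A | exists x y : A, adj x y /\ e = [set x; y]%classic}.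

Definition line_adj (e f : edge) : Prop :=
  e <> f /\ exists x : A, sval e x /\ sval f x.

Lemma line_adj_sym e f : line_adj e f -> line_adj f e.
Proof. by move=> [nef [x [ex fx]]]; split; [move/esym | exists x]. Qed.

Lemma line_adj_irrefl e : ~ line_adj e e.
Proof. by case. Qed.

Definition line_graph : sgraph := SGraph line_adj_sym line_adj_irrefl.
End Constructions.

Definition is_complement_of_line_graph (D : sgraph) : Prop :=
  exists A : sgraph, graph_iso D (complement (line_graph A)).

Section CommutingGraphs.
Variables (gT : finGroupType) (G : {group gT}).

Definition commuting_adj (x y : [subg G]) : Prop := x <> y /\ commute x y.

Lemma commuting_adj_sym x y : commuting_adj x y -> commuting_adj y x.
Proof. by move=> [nxy cxy]; split=> [/esym // |]; apply: commute_sym. Qed.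

Lemma commuting_adj_irrefl x : ~ commuting_adj x x.
Proof. by case. Qed.

Definition commuting_graph : sgraph :=
  SGraph commuting_adj_sym commuting_adj_irrefl.

Definition commuting_graph_star : sgraph :=
  @induced commuting_graph (fun x : [subg G] => x <> 1%g).

Definition commuting_graph_dstar : sgraph :=
  @induced commuting_graph (fun x => ~ dominating x).
End CommutingGraphs.

(* Main.v *)
Require Import Defs.
From mathcomp Require boolp.
From mathcomp Require Import classical_sets.
From mathcomp Require Import all_boot all_fingroup all_solvable.

Set Implicit Arguments.
Unset Strict Implicit.
Unset Printing Implicit Defensive.

(** A graph is the complement of a line graph exactly when its vertices can be
    labelled by distinct pairs of points so that two vertices are adjacent iff
    their labels are disjoint ([complement_of_line_graphP]); for a commuting
    graph, distinct elements must commute iff their labels are disjoint.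
    Central elements commute with everything, so they impose no constraint:
    each can be labelled with two points of its own. Hence only the elements
    outside the center matter, and these are common to the three graphs of the
    theorem; [commuting_model] records exactly what is shared.

    Suppose [G] is non-abelian and has such a labelling. Two configurations
    are impossible, because the non-commuting graph would contain a graph that
    is not an induced subgraph of any line graph:
    - an element that commutes with none of three distinct, pairwise commuting
      elements (a claw);
    - two commuting elements and three pairwise non-commuting ones, with no
      other commutation (a complete graph on five vertices minus an edge).
    The second one occurs on [r], [r^2], [x], [x r], [x r^2] as soon as [r]
    has order 3 and does not commute with [x]. If the center were trivial and
    [a^2 <> 1], an [x] not commuting with [a^2] would give a claw on [a],
    [a^2], [a^-1] unless [a^3 = 1], which has just been excluded; so all
    squares would be trivial and [G] abelian. Thus there is a central
    [z <> 1], and the claws built from [a], [a z] and a further element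
    commuting with [a] force the centralizer of each non-central [a] to be
    [{1, z, a, a z}] ([card_cent1]). Then the center is [{1, z}], it contains
    all squares, hence all commutators, so the classes have at most two
    elements and [G] has order [4 * 2 = 8]. The non-abelian groups of order 8
    are [D_8] and [Q_8].

    Conversely, in a non-abelian group of order 8 the six non-central elements
    form three pairs [{x, x z}], and two of them commute iff they lie in the
    same pair. The six lines of the affine plane over the field with two
    elements, that is the six edges of the complete graph on four points, fall
    into three classes of two parallel lines, and two distinct lines are
    disjoint iff they are parallel: this provides the labels. *)

(** * Complements of line graphs as disjointness graphs of pairs *)

Definition root_labelling (D : sgraph) (V : Type) (E : D -> set V) : Prop :=
  [/\ forall x, exists p q, p <> q /\ E x = [set p; q]%classic,
      injective E &
      forall x y, x <> y -> (adj x y <-> ~ exists v, E x v /\ E y v)].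

Lemma sval_inj (T : Type) (P : T -> Prop) : injective (@sval T P).
Proof.
move=> [x Px] [y Py] /= eq_xy; subst y.
by rewrite (boolp.Prop_irrelevance Px Py).
Qed.

Lemma inj_surj_bijective (S T : Type) (f : S -> T) :
  injective f -> (forall y, exists x, f x = y) -> bijective f.
Proof.
move=> f_inj f_surj; exists (fun y => sval (boolp.cid (f_surj y))) => [x|y].
  by apply: f_inj; case: boolp.cid.
by case: boolp.cid.
Qed.

(** A labelling is turned back into a graph by taking the labels themselves as
    edges; points lying on no label stay isolated, which is harmless. *)
Section RootGraph.
Variables (D : sgraph) (V : Type) (E : D -> set V).
Hypothesis labE : root_labelling E.

Definition root_adj (p q : V) : Prop :=
  p <> q /\ exists x, E x = [set p; q]%classic.

Lemma root_adj_sym p q : root_adj p q -> root_adj q p.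
Proof.
case=> npq [x Ex]; split=> [/esym //|].
by exists x; rewrite classical_sets.setUC.
Qed.

Lemma root_adj_irrefl p : ~ root_adj p p.
Proof. by case. Qed.

Definition root_graph := SGraph root_adj_sym root_adj_irrefl.

Lemma label_is_edge x :
  exists p q : root_graph, adj p q /\ E x = [set p; q]%classic.
Proof.
have [pairE _ _] := labE; have [p [q [npq Ex]]] := pairE x.
by exists p, q; split=> //; split=> //; exists x.
Qed.

Definition edge_of_label (x : D) : complement (line_graph root_graph) :=
  exist _ (E x) (label_is_edge x).

Lemma edge_of_label_iso : graph_iso D (complement (line_graph root_graph)).
Proof.
have [_ injE adjE] := labE; exists edge_of_label; split.
  apply: inj_surj_bijective => [x y /(congr1 sval) /injE //|[e edge_e]].
  have [p [q [[_ [x Ex]] def_e]]] := edge_e.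
  by exists x; apply: sval_inj; rewrite /= Ex.
move=> x y; have [-> | nxy] := boolp.pselect (x = y).
  by split=> [[]|/adj_irrefl].
have n_fxy: edge_of_label x <> edge_of_label y.
  by move/(congr1 sval)/injE.
split=> [[_ nadj] | /adjE nmeet].
  by apply/adjE => // meet; apply: nadj; split.
by split=> // -[_]; apply: nmeet.
Qed.
End RootGraph.

Lemma complement_of_line_graphP (D : sgraph) :
  is_complement_of_line_graph D <->
  exists (V : Type) (E : D -> set V), root_labelling E.
Proof.
split=> [[A [f [f_bij f_adj]]] | [V [E labE]]]; last first.
  by exists (root_graph E); apply: edge_of_label_iso labE.
have f_inj := bij_inj f_bij.
exists A, (fun x => sval (f x)); split.
- move=> x; have [p [q [adj_pq ->]]] := svalP (f x); exists p, q.
  by split=> // eq_pq; apply: (@adj_irrefl A p); rewrite {2}eq_pq.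
- by move=> x y /sval_inj /f_inj.
move=> x y nxy; have n_fxy: f x <> f y by move/f_inj.
split=> [/f_adj[_ nadj] meet | nmeet]; first by apply: nadj; split.
by apply/f_adj; split=> // -[_]; apply: nmeet.
Qed.

(** * Two forbidden configurations *)

Section ForbiddenSubgraphs.
Variables (D : sgraph) (V : Type) (E : D -> set V).
Hypothesis labE : root_labelling E.

Lemma disjoint_labels (x y : D) v : adj x y -> E x v -> ~ E y v.
Proof.
have [_ _ adjE] := labE; move=> adj_xy Exv Eyv.
have nxy: x <> y by move=> eq_xy; apply: (@adj_irrefl D x); rewrite {2}eq_xy.
by case/(adjE _ _ nxy): adj_xy; exists v.
Qed.

Lemma meeting_labels (x y : D) :
  x <> y -> ~ adj x y -> exists v, E x v /\ E y v.
Proof.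
have [_ _ adjE] := labE; move=> nxy nadj.
by apply: boolp.contrapT => nmeet; apply: nadj; apply/adjE.
Qed.

Lemma label_eq_pair x p q :
  E x p -> E x q -> p <> q -> E x = [set p; q]%classic.
Proof.
have [pairE _ _] := labE; have [s [t [_ ->]]] := pairE x.
by case=> -> [] -> // _; rewrite classical_sets.setUC.
Qed.

(** The label of [x] has two points and would have to meet three disjoint
    labels. *)
Lemma no_complement_claw (x a b c : D) :
    adj a b -> adj a c -> adj b c -> x <> a -> x <> b -> x <> c ->
  ~ adj x a -> ~ adj x b -> ~ adj x c -> False.
Proof.
move=> ab ac bc nxa nxb nxc xa xb xc.
have [pairE _ _] := labE; have [p [q [_ Ex]]] := pairE x.
have [u [Exu Eau]] := meeting_labels nxa xa.
have [v [Exv Ebv]] := meeting_labels nxb xb.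
have [w [Exw Ecw]] := meeting_labels nxc xc.
have nuv: u <> v by move=> eq_uv; subst v; apply: disjoint_labels Eau Ebv.
have nuw: u <> w by move=> eq_uw; subst w; apply: disjoint_labels Eau Ecw.
have nvw: v <> w by move=> eq_vw; subst w; apply: disjoint_labels Ebv Ecw.
by move: Exu Exv Exw; rewrite Ex => -[] ? [] ? [] ?; congruence.
Qed.

(** The labels of [x], [y], [w] each take one point from the label of [u] and
    one from the disjoint label of [v], so they are edges of a 4-cycle; among
    three distinct edges of a 4-cycle, two are opposite. *)
Lemma no_complement_K5_minus_edge (u v x y w : D) :
    adj u v ->
    (forall t, t = x \/ t = y \/ t = w ->
      [/\ u <> t, v <> t, ~ adj u t & ~ adj v t]) ->
    x <> y -> x <> w -> y <> w -> ~ adj x y -> ~ adj x w -> ~ adj y w -> False.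
Proof.
move=> uv meets nxy nxw nyw xy xw yw.
have [pairE injE _] := labE.
have [p [q [npq Eu]]] := pairE u; have [p' [q' [npq' Ev]]] := pairE v.
pose side (i : bool) := if i then p else q.
pose side' (j : bool) := if j then p' else q'.
have dis i j : side i <> side' j.
  have Eui : E u (side i) by rewrite Eu; case: i; [left | right].
  have Evj : E v (side' j) by rewrite Ev; case: j; [left | right].
  by move=> eq_ij; rewrite -eq_ij in Evj; apply: disjoint_labels Eui Evj.
have side_inj : injective side by move=> [] [] //= /esym.
have side'_inj : injective side' by move=> [] [] //= /esym.
have edge t : t = x \/ t = y \/ t = w ->
    exists i j, E t = [set side i; side' j]%classic.
  move=> /meets[nut nvt ut vt].
  have [s [Eus Ets]] := meeting_labels nut ut.
  have [s' [Evs' Ets']] := meeting_labels nvt vt.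
  have [i def_s]: exists i, s = side i.
    by move: Eus; rewrite Eu => -[]->; [exists true | exists false].
  have [j def_s']: exists j, s' = side' j.
    by move: Evs'; rewrite Ev => -[]->; [exists true | exists false].
  by exists i, j; rewrite def_s in Ets; rewrite def_s' in Ets';
     apply: label_eq_pair.
have compare t t' i j i' j' :
    E t = [set side i; side' j]%classic ->
    E t' = [set side i'; side' j']%classic ->
    t <> t' -> ~ adj t t' -> (i == i') (+) (j == j').
  (* Distinct intersecting edges of the 4-cycle share exactly one endpoint. *)
  move=> Et Et' ntt' tt'; have [r []] := meeting_labels ntt' tt'.
  have [eqi | nei] := eqVneq i i'; have [eqj | nej] := eqVneq j j' => //.
    by case: ntt'; apply: injE; rewrite Et Et' eqi eqj.
  rewrite Et Et' => -[] -> [].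
  - by move/side_inj => eqi; rewrite eqi eqxx in nei.
  - by move/dis.
  - by move/esym/dis.
  - by move/side'_inj => eqj; rewrite eqj eqxx in nej.
have [i1 [j1 E1]] := edge x (or_introl erefl).
have [i2 [j2 E2]] := edge y (or_intror (or_introl erefl)).
have [i3 [j3 E3]] := edge w (or_intror (or_intror erefl)).
move: (compare _ _ _ _ _ _ E1 E2 nxy xy) (compare _ _ _ _ _ _ E1 E3 nxw xw)
  (compare _ _ _ _ _ _ E2 E3 nyw yw).
by case: i1 i2 i3 j1 j2 j3 {E1 E2 E3} => [] [] [] [] [] [].
Qed.
End ForbiddenSubgraphs.

(** * Lines of the affine plane over the field with two elements *)

(** The three nonzero linear forms on the plane; their two level sets are the
    two lines of the corresponding parallel class. *)
Definition linear_form (d : option bool) (p : bool * bool) : bool :=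
  match d with
  | None => p.1 (+) p.2
  | Some true => p.1
  | Some false => p.2
  end.

Lemma line_pair d s :
  exists p q, p <> q /\ forall r, linear_form d r = s <-> r = p \/ r = q.
Proof.
case: d => [[]|]; [exists (s, true), (s, false) | exists (true, s), (false, s) |
                   exists (true, ~~ s), (false, s)]; split=> // -[] [] [];
  case: s; split=> //; by [move=> _; left | move=> _; right | case].
Qed.

Lemma eq_line d s d' s' :
    (forall p, linear_form d p = s <-> linear_form d' p = s') ->
  d = d' /\ s = s'.
Proof.
move=> eq_l; move: (eq_l (true, true)) (eq_l (true, false))
  (eq_l (false, true)) (eq_l (false, false)).
by case: d d' s s' {eq_l} => [[]|] [[]|] [] [] /=; intuition.
Qed.

Lemma lines_meet d s d' s' :
  d <> d' -> exists p, linear_form d p = s /\ linear_form d' p = s'.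
Proof.
by case: d d' => [[]|] [[]|] //= _;
  [exists (s, s') | exists (s, s (+) s') | exists (s', s) |
   exists (s (+) s', s) | exists (s', s (+) s') | exists (s (+) s', s')] => /=;
  case: s s' => [] [].
Qed.

(** * Commuting graphs up to central elements *)

(** [g] need only reach the non-central elements, which is what makes this hold
    for all three commuting graphs. *)
Definition commuting_model (gT : finGroupType) (G : {group gT})
    (D : sgraph) (g : D -> gT) : Prop :=
  [/\ injective g, forall u, g u \in G,
      forall x, x \in G -> x \notin 'Z(G)%g -> exists u, g u = x &
      forall u v, adj u v <-> u <> v /\ commute (g u) (g v)].

Section Groups.
Variables (gT : finGroupType) (G : {group gT}).
Implicit Types a b c x y z g : gT.
Local Open Scope group_scope.

Lemma noncentralP x :
  x \in G -> reflect (exists2 y, y \in G & ~ commute x y) (x \notin 'Z(G)).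
Proof.
move=> Gx; rewrite in_setI Gx -sub_cent1 /=.
apply: (iffP subsetPn) => -[y Gy ncxy]; exists y => //.
  by move=> cxy; case/negP: ncxy; apply/cent1P/commute_sym.
by apply/cent1P => /commute_sym.
Qed.

Lemma subg_commute (x y : subg_of G) :
  commute x y <-> commute (sgval x) (sgval y).
Proof.
split=> [/(congr1 sgval) // | cxy]; apply: val_inj; exact: cxy.
Qed.

Lemma commuting_graph_model :
  commuting_model G (fun u : commuting_graph G => sgval u).
Proof.
split=> [||x Gx _|u v]; first exact: subg_inj.
- exact: subgP.
- by exists (subg G x); rewrite subgK.
by split=> -[nuv /subg_commute].
Qed.

Lemma induced_commuting_model (P : commuting_graph G -> Prop) :
    (forall u : commuting_graph G, sgval u \notin 'Z(G) -> P u) ->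
  commuting_model G (fun u : induced P => sgval (sval u)).
Proof.
have [inj_g _ surj_g adj_g] := commuting_graph_model.
move=> PnZ; split=> [u v /inj_g/sval_inj // | u | x Gx nZx | u v].
- exact: subgP.
- have [u def_x] := surj_g x Gx nZx.
  have Pu: P u by apply: PnZ; rewrite def_x.
  by exists (exist _ u Pu).
split=> [/adj_g[nuv cuv] | [nuv cuv]].
  by split=> // eq_uv; rewrite eq_uv in nuv.
by apply/adj_g; split=> // /sval_inj.
Qed.

Lemma commuting_graph_star_model :
  commuting_model G (fun u : commuting_graph_star G => sgval (sval u)).
Proof.
by apply: induced_commuting_model => u nZu u1; rewrite u1 group1 in nZu.
Qed.

Lemma commuting_graph_dstar_model :
  commuting_model G (fun u : commuting_graph_dstar G => sgval (sval u)).
Proof.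
apply: induced_commuting_model => u /(noncentralP (subgP u))[y Gy ncuy] dom_u.
have [eq_yu | nyu] := eqVneq (subg G y) u.
  by apply: ncuy; rewrite -eq_yu subgK.
have [_ /subg_commute] := dom_u (subg G y) (elimN eqP nyu).
by rewrite /= subgK.
Qed.

(** * Consequences of a labelling for the group *)

Section CentralSquare.
Variables z a : gT.
Hypotheses (Zz : z \in 'Z(G)) (z1 : z != 1).
Hypotheses (Ga : a \in G) (nZa : a \notin 'Z(G)).

Lemma card_central_square : #|[set 1; z; a; a * z]| = 4.
Proof.
rewrite -!setUA !cardsU1 cards1 !inE !negb_or.
have a1 : a != 1 by apply: contraNneq nZa => ->; apply: group1.
have az : a != z by apply: contraNneq nZa => ->.
have aaz : a != a * z by rewrite -{1}(mulg1 a) (inj_eq (mulgI a)) eq_sym.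
have az1 : a * z != 1.
  by rewrite -eq_invg_mul; apply: contraNneq nZa => aV; rewrite -groupV aV.
have azz : a * z != z by rewrite -{2}(mul1g z) (inj_eq (mulIg z)).
by rewrite ![z == _]eq_sym ![1 == _]eq_sym z1 a1 az aaz az1 azz.
Qed.

Lemma central_square_sub : [set 1; z; a; a * z] \subset 'C_G[a].
Proof.
have [Gz cGz] := elimT (centerP _ _) Zz.
have Caz : z \in 'C_G[a] by rewrite inE Gz; apply/cent1P/cGz.
have Caa : a \in 'C_G[a] by rewrite inE Ga; apply/cent1P.
by rewrite -!setUA !subUset !sub1set group1 Caz Caa groupM.
Qed.

Lemma cent1_eq : #|'C_G[a]| = 4 -> 'C_G[a] = [set 1; z; a; a * z].
Proof.
move=> oC; apply/esym/eqP.
by rewrite eqEcard central_square_sub card_central_square oC.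
Qed.
End CentralSquare.

Section Obstruction.
Variables (D : sgraph) (g : D -> gT) (V : Type) (E : D -> set V).
Hypotheses (modG : commuting_model G g) (labE : root_labelling E).

(** Elements occurring in a non-commutation are non-central, hence are vertices
    of every model. *)
Lemma noncommuting_lift x y :
  x \in G -> y \in G -> ~ commute x y -> exists u, g u = x.
Proof.
have [_ _ surj_g _] := modG; move=> Gx Gy ncxy.
by apply: surj_g => //; apply/noncentralP => //; exists y.
Qed.

Lemma adj_of_commute (u v : D) : g u != g v -> commute (g u) (g v) -> adj u v.
Proof.
have [_ _ _ adj_g] := modG; move=> nuv cuv; apply/adj_g; split=> // eq_uv.
by rewrite eq_uv eqxx in nuv.
Qed.

Lemma not_adj_of_not_commute (u v : D) :
  ~ commute (g u) (g v) -> u <> v /\ ~ adj u v.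
Proof.
have [_ _ _ adj_g] := modG; move=> ncuv; split; last by case/adj_g.
by move=> eq_uv; apply: ncuv; rewrite eq_uv.
Qed.

Lemma no_commuting_triple x a b c :
    x \in G -> a \in G -> b \in G -> c \in G ->
    commute a b -> commute a c -> commute b c ->
    a != b -> a != c -> b != c ->
  ~ commute x a -> ~ commute x b -> ~ commute x c -> False.
Proof.
move=> Gx Ga Gb Gc cab cac cbc nab nac nbc nxa nxb nxc.
have lift y : y \in G -> ~ commute x y -> exists u, g u = y.
  by move=> Gy nxy; apply: noncommuting_lift Gy Gx _ => /commute_sym.
have [x' def_x] := noncommuting_lift Gx Ga nxa.
have [a' def_a] := lift a Ga nxa; have [b' def_b] := lift b Gb nxb.
have [c' def_c] := lift c Gc nxc; subst x a b c.
have [? ?] := not_adj_of_not_commute nxa.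
have [? ?] := not_adj_of_not_commute nxb.
have [? ?] := not_adj_of_not_commute nxc.
by apply: (no_complement_claw labE (x := x') (a := a') (b := b') (c := c'));
   rewrite // ; apply: adj_of_commute.
Qed.

Lemma commute_mulr_cancel a b c :
  commute a b -> commute a (c * b) -> commute a c.
Proof.
move=> cab cacb; rewrite -(mulgK b c); apply: commuteM => //.
exact: commuteV.
Qed.

Lemma commute_mull_cancel a b c :
  commute a b -> commute a (b * c) -> commute a c.
Proof.
move=> cab cabc; rewrite -(mulKg b c); apply: commuteM => //.
exact: commuteV.
Qed.

(** If [r] did not commute with [x], neither [r] nor [r^2] would commute with
    any element of the coset [x <[r]>], whose elements would be pairwise
    non-commuting: this is the forbidden graph on five vertices. *)
Lemma order3_central r : r \in G -> r ^+ 3 = 1 -> r \in 'Z(G).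
Proof.
move=> Gr r3; apply: contraT => nZr.
have [x Gx ncrx] := noncentralP Gr nZr.
have r1 : r != 1 by apply: contraNneq nZr => ->; apply: group1.
(* Since r^2 = r^-1, the elements r and r^2 have the same centralizer. *)
have rV : r^-1 = r ^+ 2 by apply/eqP; rewrite eq_invg_mul -expgS r3.
have ncr i : ~ commute r (x * r ^+ i).
  by move/(commute_mulr_cancel (commuteX i (commute_refl r))).
have ncrV i : ~ commute (r ^+ 2) (x * r ^+ i).
  move/commute_sym; rewrite -rV => /commuteV.
  by rewrite invgK => /commute_sym/ncr.
have nc i j : 0 < j < 3 -> ~ commute (x * r ^+ i) (x * r ^+ i * r ^+ j).
  move=> j_range /(commute_mull_cancel (commute_refl _)) /commute_sym.
  by case: j j_range => [|[|[|]]] // _; [apply: ncr | apply: ncrV].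
have Gxr i : x * r ^+ i \in G by rewrite groupM ?groupX.
have Gr2 := groupX 2 Gr.
have lift i : exists u, g u = x * r ^+ i.
  by apply: (noncommuting_lift (Gxr i) Gr) => /commute_sym/ncr.
have [u def_u] := noncommuting_lift Gr (Gxr 0%N) (ncr 0%N).
have [v def_v] := noncommuting_lift Gr2 (Gxr 0%N) (ncrV 0%N).
have [x0 def0] := lift 0%N; have [x1 def1] := lift 1%N.
have [x2 def2] := lift 2%N.
have nadj s t : ~ commute (g s) (g t) -> s <> t /\ ~ adj s t.
  exact: not_adj_of_not_commute.
have [] : x0 <> x1 /\ ~ adj x0 x1.
  by apply: nadj; rewrite def0 def1;
     have:= nc 0%N 1%N isT; rewrite -mulgA -expgD.
have [] : x0 <> x2 /\ ~ adj x0 x2.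
  by apply: nadj; rewrite def0 def2;
     have:= nc 0%N 2%N isT; rewrite -mulgA -expgD.
have [] : x1 <> x2 /\ ~ adj x1 x2.
  by apply: nadj; rewrite def1 def2;
     have:= nc 1%N 1%N isT; rewrite -mulgA -expgD.
move=> n12 a12 n02 a02 n01 a01; exfalso.
apply: (no_complement_K5_minus_edge labE (u := u) (v := v))
  n01 n02 n12 a01 a02 a12.
  apply: adj_of_commute; rewrite def_u def_v; last exact: commuteX.
  by rewrite expgS expg1 -{1}(mulg1 r) (inj_eq (mulgI r)) eq_sym.
move=> t t012; have [i def_t] : exists i, g t = x * r ^+ i.
  by case: t012 => [|[]] ->; [exists 0%N | exists 1%N | exists 2%N].
have [? ?] : u <> t /\ ~ adj u t by apply: nadj; rewrite def_u def_t.
by have [? ?] : v <> t /\ ~ adj v t by apply: nadj; rewrite def_v def_t.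
Qed.

(** Otherwise some [a^2] is non-trivial, hence non-central, and [a], [a^2],
    [a^-1] form a claw with any [x] not commuting with [a^2]; they are distinct
    because no element of order 3 exists. *)
Lemma nontrivial_center : ~~ abelian G -> 'Z(G) != 1.
Proof.
apply: contra => /eqP Z1; have sq1 a : a \in G -> a ^+ 2 = 1.
  move=> Ga; apply/eqP; apply: contraT => a2_1.
  have a_1 : a != 1 by apply: contraNneq a2_1 => ->; rewrite expg1n.
  have a3_1 : a ^+ 3 != 1.
    apply: contraNneq a_1 => /(order3_central Ga).
    by rewrite Z1 inE.
  have Ga2 := groupX 2 Ga.
  have nZa2 : a ^+ 2 \notin 'Z(G) by rewrite Z1 inE.
  have [x Gx nca2x] := noncentralP Ga2 nZa2.
  have caa : commute a a by [].
  apply: False_ind; apply: (no_commuting_triple Gx Ga Ga2 (groupVr Ga)).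
  - exact: commuteX.
  - exact: commuteV.
  - by apply: commuteV; apply: commute_sym; apply: commuteX.
  - by rewrite expgS expg1 -{1}(mulg1 a) (inj_eq (mulgI a)) eq_sym.
  - by rewrite eq_sym eq_invg_mul.
  - by rewrite eq_sym eq_invg_mul -expgS.
  - by move=> cxa; apply: nca2x; apply: commute_sym; apply: commuteX.
  - by move/commute_sym.
  - by move=> /commuteV; rewrite invgK => cxa; apply: nca2x;
      apply: commute_sym; apply: commuteX.
rewrite (abelem_abelian (p := 2)) // exponent2_abelem //.
by apply/exponentP.
Qed.

(** If [x] does not commute with [a], it commutes with neither [a] nor [a z];
    for [b] outside [{1, z, a, a z}] commuting with [a], it fails to
    commute with [b] or with [a b], which completes a claw. *)
Lemma card_cent1 z a :
  z \in 'Z(G) -> z != 1 -> a \in G -> a \notin 'Z(G) -> #|'C_G[a]| = 4.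
Proof.
move=> Zz z1 Ga nZa.
suffices ->: 'C_G[a] = [set 1; z; a; a * z] by apply: card_central_square.
apply/eqP; rewrite eqEsubset central_square_sub // andbT.
have [x Gx ncax] := noncentralP Ga nZa; have [Gz cGz] := elimT (centerP _ _) Zz.
apply/subsetP=> b /setIP[Gb /cent1P/commute_sym cab].
rewrite !inE -!orbA; apply: contraT; rewrite !negb_or => /and4P[b1 bz ba baz].
have caz : commute a (a * z) by apply: commuteM => //; apply/commute_sym/cGz.
have cbz : commute (a * z) b.
  by apply/commute_sym/commuteM; [apply: commute_sym | apply/commute_sym/cGz].
have Gaz := groupM Ga Gz; have a_az : a != a * z.
  by rewrite -{1}(mulg1 a) (inj_eq (mulgI a)) eq_sym.
have ncxa : ~ commute x a by move/commute_sym.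
have ncxaz : ~ commute x (a * z).
  by move/(commute_mulr_cancel (commute_sym (cGz x Gx))).
apply: False_ind; have [/eqP cxb | /eqP ncxb] := eqVneq (x * b) (b * x).
  apply: (no_commuting_triple Gx Ga Gaz (groupM Ga Gb)) => //.
  - exact: commuteM.
  - by apply: commuteM => //; apply: commute_sym.
  - by rewrite -{1}(mulg1 a) (inj_eq (mulgI a)) eq_sym.
  - by rewrite (inj_eq (mulgI a)) eq_sym.
  by move/(commute_mulr_cancel (eqP cxb)).
apply: (no_commuting_triple Gx Ga Gaz Gb) => //; by rewrite eq_sym.
Qed.

(** Squares are central because [a^2] lies in [{1, z, a, a z}] but equals
    neither [a] nor [a z]. So the quotient by the center is abelian, the class
    of [a] lies in [{a, a z}], and the centralizer of [a] has index 2. *)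
Lemma card_nonabelian : ~~ abelian G -> #|G| = 8.
Proof.
move=> nabG; have /trivgPn[z Zz z1] := nontrivial_center nabG.
have [a Ga nZa] : exists2 a, a \in G & a \notin 'Z(G).
  by apply/subsetPn; apply: contra nabG => /subset_trans/(_ (subsetIr _ _)).
have CE x (Gx : x \in G) (nZx : x \notin 'Z(G)) :=
  cent1_eq Zz z1 Gx nZx (card_cent1 Zz z1 Gx nZx).
have sZ : 'Z(G) \subset [set 1; z].
  apply/subsetP=> y Zy; have [Gy cGy] := elimT (centerP _ _) Zy.
  have: y \in 'C_G[a] by rewrite inE Gy; apply/cent1P/cGy.
  rewrite CE // !inE -!orbA => /or4P[-> // | -> | /eqP eq_y | /eqP eq_y].
  - by rewrite orbT.
  - by rewrite -eq_y Zy in nZa.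
  by case/negP: nZa; rewrite -(mulgK z a) -eq_y groupM ?groupV.
have sqZ x : x \in G -> x ^+ 2 \in 'Z(G).
  move=> Gx; have [Zx | nZx] := boolP (x \in 'Z(G)); first exact: groupX.
  have: x ^+ 2 \in 'C_G[x].
    by rewrite inE groupX //=; apply/cent1P/commute_sym/commuteX.
  rewrite CE // expgS expg1.
  have -> : (x * x \in [set 1; z; x; x * z]) =
            [|| x * x == 1, x * x == z, x == 1 | x == z].
    by rewrite !inE -!orbA -{7}(mulg1 x) !(inj_eq (mulgI x)).
  case/or4P=> /eqP eq_x; rewrite ?eq_x ?group1 //.
    by rewrite eq_x group1 in nZx.
  by rewrite eq_x Zz in nZx.
have abelGZ : abelian (G / 'Z(G)).
  rewrite (abelem_abelian (p := 2)) // exponent2_abelem //.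
  apply/exponentP=> _ /morphimP[x Nx Gx ->].
  by rewrite -morphX //; apply: coset_id; apply: sqZ.
have sG'Z : G^`(1) \subset 'Z(G) by rewrite der1_min // gFnorm.
have class_le2 : #|a ^: G| <= 2.
  have sub : a ^: G \subset [set a * y | y in [set 1; z]].
    apply/subsetP=> _ /imsetP[x Gx ->]; apply/imsetP; exists [~ a, x].
      by apply: (subsetP sZ); apply: (subsetP sG'Z); apply: mem_commg.
    by rewrite conjg_mulR.
  apply: leq_trans (subset_leq_card sub) _.
  by apply: leq_trans (leq_imset_card _ _) _; rewrite cards2; case: eqP.
have index_gt1 : 1 < #|G : 'C_G[a]|.
  rewrite indexg_gt1; apply: contra nZa => sGC.
  by rewrite inE Ga -sub_cent1 (subset_trans sGC) ?subsetIr.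
rewrite -(Lagrange (subsetIl G 'C[a])) (card_cent1 Zz z1 Ga nZa).
rewrite -index_cent1 in class_le2.
by rewrite (_ : #|G : _| = 2) //; apply/eqP; rewrite eqn_leq class_le2.
Qed.
End Obstruction.

(** * Non-abelian groups of order 8 *)

Section Order8.
Hypotheses (nabG : ~~ abelian G) (oG : #|G| = 8).

Lemma extraspecial_card8 : extraspecial G.
Proof. by apply: (@p3group_extraspecial 2); rewrite /pgroup ?oG. Qed.

Lemma card8_center : #|'Z(G)| = 2.
Proof.
by apply: (card_center_extraspecial _ extraspecial_card8); rewrite /pgroup oG.
Qed.

Lemma card8_cent1 x : x \in G -> x \notin 'Z(G) -> #|'C_G[x]| = 4.
Proof.
move=> Gx nZx.
have properZ : 'Z(G) \proper 'C_G[x].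
  apply/properP; split; first by rewrite setIS // -cent_set1 centS // sub1set.
  by exists x; rewrite // inE Gx; apply/cent1P.
have properC : 'C_G[x] \proper G.
  rewrite properE subsetIl; apply: contra nZx => sGC.
  by rewrite inE Gx -sub_cent1 (subset_trans sGC) ?subsetIr.
have := proper_card properZ; have := proper_card properC.
have := cardSg (proper_sub properZ); have := cardSg (proper_sub properC).
(* A multiple of 2 dividing 8, strictly between 2 and 8. *)
by rewrite card8_center oG; move: #|_| => n; do 9!case: n => [//|n] //.
Qed.

(** The centralizer of [w] has order 4, the square of a prime, so it is
    abelian. *)
Lemma card8_commute_trans w x y :
    w \in G -> w \notin 'Z(G) -> x \in G -> y \in G ->
  commute w x -> commute w y -> commute x y.
Proof.
move=> Gw nZw Gx Gy cwx cwy.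
have abC : abelian 'C_G[w].
  by apply: (@card_p2group_abelian _ 2) => //; rewrite card8_cent1.
by apply: (centsP abC); rewrite inE ?Gx ?Gy; apply/cent1P/commute_sym.
Qed.

(** The centralizer of [w] has index 2, so any two elements outside it are in
    the same coset. *)
Lemma card8_div_cent1 w x y :
    w \in G -> w \notin 'Z(G) -> x \in G -> y \in G ->
  ~ commute w x -> ~ commute w y -> commute w (y * x^-1).
Proof.
move=> Gw nZw Gx Gy ncwx ncwy.
have iC : #|G : 'C_G[w]| = 2 by rewrite -divgS ?subsetIl // oG card8_cent1.
have nC t : t \in G -> ~ commute w t -> t \in G :\: 'C_G[w].
  move=> Gt ncwt; rewrite in_setD Gt andbT.
  by apply/negP => /setIP[_ /cent1P/commute_sym].
have eqC : 'C_G[w] :* x = 'C_G[w] :* y.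
  by rewrite !(rcoset_index2 (subsetIl _ _) iC) // nC.
have : y * x^-1 \in 'C_G[w] by rewrite -mem_rcoset eqC rcoset_refl.
by case/setIP=> _ /cent1P/commute_sym.
Qed.

(** The direction of [x] tells which of the centralizers of [a], [b], [a b]
    contains it, where [a] and [b] are fixed non-commuting elements. The sign
    compares the ranks of [x] and [x z] in the enumeration of the group, a
    choice that separates [x] from [x z] without naming representatives. *)
Lemma card8_directions : exists (dir : gT -> option bool) (sign : gT -> bool),
  forall x y, x \in G :\: 'Z(G) -> y \in G :\: 'Z(G) ->
  (commute x y <-> dir x = dir y) /\
  (commute x y -> x <> y -> sign x <> sign y).
Proof.
have /trivgPn[z Zz z1] : 'Z(G) != 1 by rewrite -cardG_gt1 card8_center.
have twin x y : x \in G :\: 'Z(G) -> y \in G :\: 'Z(G) -> commute x y ->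
    y = x \/ y = x * z.
  move=> /setDP[Gx nZx] /setDP[Gy nZy] cxy.
  have : y \in 'C_G[x] by rewrite inE Gy; apply/cent1P/commute_sym.
  rewrite (cent1_eq Zz z1 Gx nZx (card8_cent1 Gx nZx)).
  case/setUP=> [/setUP[/set2P[] eq_y | /set1P] | /set1P];
    [| | by left | by right].
    by rewrite eq_y group1 in nZy.
  by rewrite eq_y Zz in nZy.
have [a Ga nZa] : exists2 a, a \in G & a \notin 'Z(G).
  by apply/subsetPn; apply: contra nabG => /subset_trans/(_ (subsetIr _ _)).
have [b Gb ncab] := noncentralP Ga nZa.
have nZb : b \notin 'Z(G).
  by apply/(noncentralP Gb); exists a => // /commute_sym.
exists (fun x => if x \in 'C[a] then Some true
                 else if x \in 'C[b] then Some false else None).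
exists (fun x => enum_rank x < enum_rank (x * z)) => x y GZx GZy.
have [[Gx nZx] [Gy nZy]] := (setDP GZx, setDP GZy).
split; last first.
  move=> cxy nxy; have [/esym // | eq_y] := twin x y GZx GZy cxy.
  have [// | eq_x] := twin y x GZy GZx (commute_sym cxy).
  rewrite -eq_y -eq_x; case: ltngtP => // /ord_inj/enum_rank_inj //.
have cent1_zr t : t \in G -> (x * z \in 'C[t]) = (x \in 'C[t]).
  move=> Gt; rewrite groupMr //; have [_ cGz] := elimT (centerP _ _) Zz.
  by apply/cent1P/cGz.
split=> [cxy | ].
  by have [-> | ->] := twin x y GZx GZy cxy; rewrite ?cent1_zr.
case: (@cent1P _ x a) => [/commute_sym cax | ncxa];
  case: (@cent1P _ y a) => [/commute_sym cay | ncya]; try by case: ifP.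
  by move=> _; apply: (card8_commute_trans Ga nZa).
case: (@cent1P _ x b) => [/commute_sym cbx | ncxb];
  case: (@cent1P _ y b) => [/commute_sym cby | ncyb] // _.
  exact: (card8_commute_trans Gb nZb).
(* Two elements commuting with neither a nor b differ by an element that
   commutes with both, which can only be central. *)
have caw : commute a (y * x^-1).
  by apply: (card8_div_cent1 Ga nZa) => // /commute_sym.
have cbw : commute b (y * x^-1).
  by apply: (card8_div_cent1 Gb nZb) => // /commute_sym.
have Gw : y * x^-1 \in G by rewrite groupM ?groupV.
have Zw : y * x^-1 \in 'Z(G).
  apply: contraT => nZw; case: ncab.
  by apply: (card8_commute_trans Gw nZw) => //; apply: commute_sym.
have [_ cGw] := elimT (centerP _ _) Zw.
by rewrite -(mulgKV x y); apply: commuteM => //; apply/commute_sym/cGw.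
Qed.
End Order8.

(** * The labelling by lines *)

Section LineLabelling.
Variables (D : sgraph) (g : D -> gT) (modG : commuting_model G g).
Variables (dir : gT -> option bool) (sign : gT -> bool).
Hypothesis dirP : forall x y, x \in G :\: 'Z(G) -> y \in G :\: 'Z(G) ->
  (commute x y <-> dir x = dir y).
Hypothesis signP : forall x y, x \in G :\: 'Z(G) -> y \in G :\: 'Z(G) ->
  commute x y -> x <> y -> sign x <> sign y.

(** A central [u] gets the two private points [(u, true)] and [(u, false)]; a
    non-central one gets a line of the plane. *)
Definition line_label (u : D) : set (D * bool + bool * bool) := fun v =>
  match v with
  | inl w => (g u \in 'Z(G)) /\ w.1 = u
  | inr p => (g u \notin 'Z(G)) /\ linear_form (dir (g u)) p = sign (g u)
  end.

Lemma line_labelling : root_labelling line_label.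
Proof.
have [inj_g Gg surj_g adj_g] := modG.
have GZ u : g u \notin 'Z(G) -> g u \in G :\: 'Z(G) by rewrite in_setD Gg andbT.
split=> [u | u v eq_uv | u v nuv].
- have [Zu | nZu] := boolP (g u \in 'Z(G)).
    exists (inl (u, true)), (inl (u, false)); split=> //.
    rewrite boolp.predeqE => -[[w b] | p] /=; rewrite Zu;
      last by split=> [[]|[]].
    split=> [[_ /= ->] | [[->]|[->]] //].
    by case: b; [left | right].
  have [p [q [npq lineE]]] := line_pair (dir (g u)) (sign (g u)).
  exists (inr p), (inr q); split=> [[] // |].
  rewrite boolp.predeqE => -[w | r] /=.
    by rewrite (negPf nZu); split=> [[]|[]].
  rewrite nZu; split=> [[_ /lineE[]->] | [] [->]]; try by [left | right].
    by split=> //; apply/lineE; left.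
  by split=> //; apply/lineE; right.
- have [Zu | nZu] := boolP (g u \in 'Z(G)).
    have: line_label u (inl (u, true)) by [].
    by rewrite eq_uv => -[_].
  have nZv : g v \notin 'Z(G).
    apply/negP => Zv; have: line_label v (inl (v, true)) by [].
    by rewrite -eq_uv => -[]; rewrite (negPf nZu).
  have eq_lines p : linear_form (dir (g u)) p = sign (g u) <->
                    linear_form (dir (g v)) p = sign (g v).
    split=> lp.
      by have: line_label u (inr p) by []; rewrite eq_uv => -[].
    by have: line_label v (inr p) by []; rewrite -eq_uv => -[].
  have [eq_dir eq_sign] := eq_line eq_lines.
  apply: boolp.contrapT => nuv.
  apply: (signP (GZ u nZu) (GZ v nZv)) => // [|/inj_g //].
  by apply/dirP => //; apply: GZ.
have [Zu | nZu] := boolP (g u \in 'Z(G)).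
  have [_ cGu] := elimT (centerP _ _) Zu.
  split=> [_ [[w [[_ /= eq_u] [_ /= eq_v]]|p [[]]]] | _].
  - by apply: nuv; rewrite -eq_u.
  - by rewrite Zu.
  by apply/adj_g; split=> //; apply: cGu.
have [Zv | nZv] := boolP (g v \in 'Z(G)).
  have [_ cGv] := elimT (centerP _ _) Zv.
  split=> [_ [[w [[]]|p [_ []]]] | _]; rewrite ?Zv ?(negPf nZu) //.
  by apply/adj_g; split=> //; apply/commute_sym/cGv.
have [GZu GZv] := (GZ u nZu, GZ v nZv).
split=> [/adj_g[_ cuv] [[w [[]]|p [[_ lu] [_ lv]]]] | nmeet].
- by rewrite (negPf nZu).
- have /dirP eq_dir := cuv; apply: (signP GZu GZv cuv) => [/inj_g //|].
  by rewrite -lu -lv eq_dir.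
apply/adj_g; split=> //; apply/dirP => //; apply: boolp.contrapT => n_dir.
have [p [lu lv]] := lines_meet (sign (g u)) (sign (g v)) n_dir.
by apply: nmeet; exists (inr p).
Qed.
End LineLabelling.

(** * The classification *)

Lemma commuting_model_line_graph (D : sgraph) (g : D -> gT) :
    commuting_model G g ->
  is_complement_of_line_graph D <-> (abelian G \/ #|G| = 8).
Proof.
move=> modG; have [abG | nabG] := boolP (abelian G).
  split=> [_ | _]; first by left.
  have noncentral0 x : x \notin G :\: 'Z(G).
    by rewrite (center_idP abG) setDv in_set0.
  (* As no element is non-central, any directions and signs will do. *)
  apply/complement_of_line_graphP; do 2!eexists.
  apply: (line_labelling modG (dir := xpredT \; Some) (sign := xpredT)) => x y;
    by rewrite (negPf (noncentral0 x)).
split=> [/complement_of_line_graphP[V [E labE]] | [// | oG]].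
  by right; apply: card_nonabelian modG labE nabG.
have [dir [sign dirsignP]] := card8_directions nabG oG.
apply/complement_of_line_graphP; do 2!eexists.
apply: (line_labelling modG (dir := dir) (sign := sign)) => x y GZx GZy.
  by have [] := dirsignP x y GZx GZy.
by have [_] := dirsignP x y GZx GZy.
Qed.

Lemma nonabelian_card8 :
  ~~ abelian G -> #|G| = 8 <-> (G \isog 'D_8 \/ G \isog 'Q_8).
Proof.
move=> nabG; split=> [oG | [] /card_isog ->].
- by apply/orP; apply: card_isog8_extraspecial oG (extraspecial_card8 nabG oG).
- exact: (@card_2dihedral 3).
exact: (@card_quaternion 3).
Qed.
End Groups.

(* 'D_8 and 'Q_8 are indexed by their order. *)
Theorem theorem3p4 (gT : finGroupType) (G : {group gT}) (Delta : sgraph)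
    (hDelta : Delta = commuting_graph G \/ Delta = commuting_graph_star G \/
              Delta = commuting_graph_dstar G) :
  is_complement_of_line_graph Delta <->
  (abelian G \/
   (~ abelian G /\ (G \isog ('D_8)%g \/ G \isog ('Q_8)%g))).
Proof.
have [g modG] : exists g : Delta -> gT, commuting_model G g.
  case: hDelta => [|[]] ->; eexists; [exact: commuting_graph_model |
    exact: commuting_graph_star_model | exact: commuting_graph_dstar_model].
apply: (iff_trans (commuting_model_line_graph modG)).
have [abG | nabG] := boolP (abelian G); first by split; left.
split=> [[// | /(nonabelian_card8 nabG) isoG] | [// | [_ isoG]]].
  by right; split=> //; apply/negP.
by right; apply/(nonabelian_card8 nabG).
Qed.
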